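(* Let $m\ge 1$ and $k\ge 1$ be integers such that every prime factor of $m$ is greater than $k!$. Then any subset $S$ of size $k$ of $D_{2m}\setminus\{0\}$ is sequenceable.
   Context: Groups are written additively even when they are not abelian, and $0$ denotes the identity element. $D_{2m}$ is the dihedral group of order $2m$, defined as $\mathbb{Z}_m\rtimes_{\varphi}\mathbb{Z}_2$ with $\varphi(0)=\mathrm{id}$ and $\varphi(1)(x)=-x$, i.e. the set $\mathbb{Z}_m\times\mathbb{Z}_2$ with operation $(x,h)+(y,g)=(x+\varphi(h)(y),\ h+g)$. A finite subset $S$ of size $k$ of a group is sequenceable if there is an ordering $(x_1,\dots,x_k)$ of its elements such that the partial sums $(s_0,s_1,\dots,s_k)$, given by $s_0=0$ and $s_i=x_1+x_2+\dots+x_i$ (summed in this order) for $1\le i\le k$, are pairwise distinct, with the possible exception that $s_k=s_0=0$ is allowed. *)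

(* Defs.v *)
From HB Require Import structures.
From mathcomp Require Import all_boot all_order all_algebra all_fingroup.

Set Implicit Arguments.
Unset Strict Implicit.
Unset Printing Implicit Defensive.

Import GRing.Theory.
Local Open Scope ring_scope.

(* Z_m x Z_2, the carrier of D_{2m} = Z_m ><| Z_2.  The cyclic factor is       *)
(* 'I_m.-1.+1, which is 'I_m for every m > 0; 'Z_m would be wrong at m = 1.    *)
(* For the same reason 'D_(2 * m) from extremal.v is not used: at m = 1 it has *)
(* order 4.                                                                    *)
Definition dihedral (m : nat) : Type := ('I_m.-1.+1 * 'Z_2)%type.

HB.instance Definition _ (m : nat) := Finite.on (dihedral m).

Section DihedralGroup.

Variable m : nat.

Definition dihedral_phi (h : 'Z_2) (x : 'I_m.-1.+1) : 'I_m.-1.+1 :=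
  if h == 0 then x else - x.

Definition dihedral_add (u v : dihedral m) : dihedral m :=
  (u.1 + dihedral_phi u.2 v.1, u.2 + v.2).

Definition dihedral_zero : dihedral m := (0, 0).

Definition dihedral_opp (u : dihedral m) : dihedral m :=
  (- dihedral_phi u.2 u.1, u.2).

Lemma Z2_cases (h : 'Z_2) : h = 0 \/ h = 1.
Proof.
by case: h => [[|[|n]] lt_n] //; [left | right]; apply: val_inj.
Qed.

Lemma dihedral_addA : associative dihedral_add.
Proof.
case=> x h [y g] [z f]; rewrite /dihedral_add /dihedral_phi /= addrA.
congr (_, _); rewrite -addrA; congr (_ + _).
by case: (Z2_cases h) => ->; case: (Z2_cases g) => -> /=;
   rewrite ?opprD ?opprK.
Qed.

Lemma dihedral_add0 : left_id dihedral_zero dihedral_add.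
Proof. by case=> x h; rewrite /dihedral_add /dihedral_phi /= !add0r. Qed.

Lemma dihedral_addN : left_inverse dihedral_zero dihedral_opp dihedral_add.
Proof.
case=> x h; rewrite /dihedral_add /dihedral_phi /dihedral_zero /=.
case: (Z2_cases h) => -> /=; rewrite ?addNr ?opprK ?addrN ?addr0 //.
by congr (_, _); apply: val_inj.
Qed.

End DihedralGroup.

(* The group law, written additively on paper, is MathComp's multiplicative    *)
(* one: 0 becomes 1%g and sums become products.                                *)
HB.instance Definition _ (m : nat) :=
  Finite_isGroup.Build (dihedral m)
    (@dihedral_addA m) (@dihedral_add0 m) (@dihedral_addN m).

Lemma card_dihedral (m : nat) : (0 < m)%N -> #|{: dihedral m}| = (2 * m)%N.
Proof. by move=> m_gt0; rewrite card_prod !card_ord prednK // mulnC. Qed.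

Lemma dihedral_mulE (m : nat) (u v : dihedral m) :
  (u * v)%g = (u.1 + (if u.2 == 0 then v.1 else - v.1), u.2 + v.2).
Proof. by []. Qed.

Lemma dihedral_oneE (m : nat) : (1%g : dihedral m) = (0, 0).
Proof. by []. Qed.

Definition partial_sum (G : groupType) (xs : seq G) (i : nat) : G :=
  (\prod_(x <- take i xs) x)%g.

(* i = 0, j = size xs is the permitted coincidence s_k = s_0 = 0.  The set S   *)
(* is finite because xs enumerates it.                                         *)
Definition sequenceable (G : groupType) (S : {pred G}) : Prop :=
  exists xs : seq G,
    [/\ uniq xs, xs =i S &
        forall i j : nat, (i < j <= size xs)%N ->
          partial_sum xs i = partial_sum xs j -> i = 0%N /\ j = size xs].

(* Main.v *)
Require Import Defs.
From mathcomp Require Import all_boot all_order all_algebra all_fingroup.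
From mathcomp Require Import zify lra.

(** An ordering of [S] is good when no contiguous block of it, except possibly
    the whole of it, multiplies to the identity.  A block multiplies to the
    identity exactly when it contains an even number of reflections and a
    certain sum of its cyclic coordinates, with signs [+1] and [-1] that depend
    only on where the reflections stand, is zero.  So whether an ordering is
    good depends only on which linear forms with coefficients in [{-1, 0, 1}]
    vanish at the coordinates.

    Because the primes dividing [m] exceed [k!], the [k] coordinates can be
    replaced by rational numbers satisfying the same relations of that kind
    ([rectification]): if a form [v] lies in the rational span of the vanishing
    forms, Cramer's rule writes [d v] as an integral combination of them, with
    [d] a nonzero minor of a matrix with entries in [{-1, 0, 1}]; such a minor
    is at most [k!] in absolute value, hence invertible modulo [m], and [v]
    vanishes too.  The rational coordinates are those of a generic common zero
    of the vanishing forms.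

    It remains to order a set of non-identity elements of the semidirect product
    of the rationals by a sign change.  Follow the walk of partial products on
    two copies of the line, where a rotation stays on its copy and a reflection
    changes copy.
    - If there are reflections ([ordering_with_reflections]), pick a rational
      [c] with half of the reflections below it.  Translating one copy of the
      line by [c] makes the walk move strictly to the right all the time, as
      soon as the positive rotations and the reflections above [c] are used on
      the first copy, the other elements on the second one; so no block is
      trivial.
    - Otherwise ([ordering_without_reflections]), put the positive elements
      first and the negative ones last.  A trivial block straddles the turning
      point, so the two families need only be ordered so that their partial
      sums, counted from the turning point, are disjoint
      ([disjoint_partial_sums]); this uses that the elements are distinct. *)

Set Implicit Arguments.
Unset Strict Implicit.
Unset Printing Implicit Defensive.

Import Order.TTheory GRing.Theory Num.Theory.
Local Open Scope ring_scope.

(** * Replacing the coordinates by rational numbers *)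

(** The Leibniz formula has [r`!] terms, each at most [1]. *)
Lemma norm_det_le_fact (r : nat) (B : 'M[int]_r) :
  (forall i j, `|B i j| <= 1) -> `|\det B| <= r`!%:R.
Proof.
move=> B_le1; apply: le_trans (ler_norm_sum _ _ _) _.
rewrite -card_Sn -sumr_const; apply: ler_sum => s _.
rewrite normrM normr_sign mul1r normr_prod.
by apply: prodr_ile1 => i _; rewrite normr_ge0 B_le1.
Qed.

(** Cramer's rule on a maximal invertible square submatrix of [M], whose
    determinant is the multiplier [d]; its size is at most [n], which bounds
    [d]. *)
Lemma integral_multiple_in_rowspan (N n : nat) (M : 'M[int]_(N, n))
    (v : 'rV[int]_n) :
  (forall i j, `|M i j| <= 1) ->
  (map_mx intr v <= (map_mx intr M : 'M[rat]_(N, n)))%MS ->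
  exists (d : int) (c : 'rV[int]_N),
    [/\ d != 0, `|d| <= n`!%:R & d *: v = c *m M].
Proof.
move=> M_le1; set MQ := map_mx _ M => v_in_M.
pose g := maxrankfun MQ; pose A := rowsub g M.
pose AQ := rowsub g MQ.
have AQE : map_mx intr A = AQ by apply/matrixP => i j; rewrite !mxE.
have freeA : row_free AQ by apply: maxrowsub_free.
have fullAt : row_full AQ^T by rewrite /row_full mxrank_tr.
pose f := fullrankfun fullAt; pose B := colsub f A.
have BQE : map_mx intr B = (rowsub f AQ^T)^T :> 'M[rat]_ _.
  by apply/matrixP => i j; rewrite !mxE.
have detB : (\det B)%:~R != 0 :> rat.
  rewrite -det_map_mx BQE det_tr -unitfE.
  by have := fullrowsub_unit fullAt; rewrite unitmxE.
have /submxP[D vE] : (map_mx intr v <= AQ)%MS by rewrite eq_maxrowsub.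
have fv : map_mx intr (colsub f v) = D *m map_mx intr B :> 'rV[rat]_ _.
  by rewrite map_mxsub vE map_mxsub AQE; apply/matrixP => i j; rewrite !mxE;
     apply: eq_bigr => l _; rewrite !mxE.
pose c := colsub f v *m \adj B.
have cE : map_mx intr c = (\det B)%:~R *: D :> 'rV[rat]_ _.
  rewrite map_mxM fv map_mx_adj -mulmxA mul_mx_adj det_map_mx.
  by rewrite mul_mx_scalar.
exists (\det B), (c *m rowsub g 1%:M); split.
- by apply: contraNneq detB => ->.
- apply: le_trans (norm_det_le_fact _) _.
    by move=> i j; rewrite !mxE.
  by rewrite ler_nat leq_fact // rank_leq_col.
- have int_mx_inj p q : injective (map_mx intr : 'M[int]_(p, q) -> 'M[rat]_(p, q)).
    move=> X Y /matrixP XY; apply/matrixP => i j.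
    by have := XY i j; rewrite !mxE => /intr_inj.
  apply: int_mx_inj.
  rewrite -mulmxA mul_rowsub_mx mul1mx map_mxM AQE cE map_mxZ vE.
  by rewrite -scalemxAl.
Qed.

Lemma nonzero_at_some_nat (p : {poly rat}) : p != 0 -> exists x : nat, p.[x%:R] != 0.
Proof.
move=> p_neq0.
have /allPn[_ /mapP[x _ ->] px] :
    ~~ all (root p) [seq x%:R | x <- iota 0 (size p)].
  apply/negP => /(max_poly_roots p_neq0); rewrite size_map size_iota ltnn.
  rewrite map_inj_uniq ?iota_uniq => [/(_ isT)//|x y /eqP].
  by rewrite eqr_nat => /eqP.
by exists x.
Qed.

(** A vector space over an infinite field is not a finite union of hyperplanes;
    the functional is found on the moment curve, where a hyperplane amounts to
    the roots of a nonzero polynomial. *)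
Lemma generic_functional (n : nat) (us : seq 'rV[rat]_n) :
  exists z : 'cV[rat]_n, forall u, u \in us -> u *m z = 0 -> u = 0.
Proof.
pose p := \prod_(u <- us | u != 0) rVpoly u.
have /nonzero_at_some_nat[x px] : p != 0.
  rewrite /p; elim/big_rec: _ => [|u q u_neq0 q_neq0]; first exact: oner_neq0.
  rewrite mulf_neq0 //; apply: contraNneq u_neq0 => u0.
  by rewrite -(rVpolyK u) u0 linear0.
exists (\col_j x%:R ^+ j) => u us_u uz; apply: contraNeq px => u_neq0.
rewrite /p horner_prod (big_rem u) //= u_neq0 mulf_eq0; apply/orP; left.
have <- : (u *m \col_j x%:R ^+ j) 0 0 = (rVpoly u).[x%:R].
  rewrite !mxE (@horner_coef_wide _ n) ?size_poly //.
  by apply: eq_bigr => j _; rewrite coef_rVpoly_ord mxE.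
by rewrite uz mxE.
Qed.

(** The forms vanishing at [a] are the rows of [M] below.  The classes of the
    basis vectors modulo the row space of [M] satisfy these relations and no
    other one in the range considered: another such form would have a multiple,
    by some nonzero [d] with [|d| <= n!], that is an integral combination of the
    rows, so [d] would annihilate its value at [a], which is not zero.  A
    generic functional turns these classes into rational numbers. *)
Lemma rectification (V : zmodType) (n : nat) (a : 'I_n -> V) :
  (forall (d : nat) x, (0 < d <= n`!)%N -> x *+ d = 0 :> V -> x = 0) ->
  exists b : 'I_n -> rat, forall e : 'I_n -> int, (forall i, `|e i| <= 1) ->
    (\sum_i a i *~ e i == 0) = (\sum_i b i *~ e i == 0).
Proof.
move=> torsion_free.
pose ev (e : 'rV[int]_n) : V := \sum_i a i *~ e 0 i.
(* [T] encodes the coefficient vectors, with the digits 0, 1, 2 standing for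
   -1, 0, 1; a row of [M] whose form does not vanish at [a] is set to zero. *)
pose T := {ffun 'I_n -> 'I_3}.
pose vec (t : T) : 'rV[int]_n := \row_j ((t j)%:Z - 1).
have vec_le1 t j : `|vec t 0 j| <= 1.
  by rewrite mxE; case: (t j) => [[|[|[|]]]].
have vec_onto (e : 'rV[int]_n) : (forall i, `|e 0 i| <= 1) -> exists t, e = vec t.
  move=> e_le1; exists [ffun j => inord (absz (e 0 j + 1))].
  apply/rowP => j; rewrite mxE ffunE inordK; have := e_le1 j; lia.
pose M : 'M[int]_(#|{: T}|, n) := \matrix_(r, j)
  (if ev (vec (enum_val r)) == 0 then vec (enum_val r) 0 j else 0).
have M_le1 i j : `|M i j| <= 1 by rewrite mxE; case: ifP.
have evM r : ev (row r M) = 0.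
  rewrite /ev; case: (eqVneq (ev (vec (enum_val r))) 0) => [ev0|ev_neq0].
    by rewrite -[RHS]ev0; apply: eq_bigr => i _; rewrite !mxE ev0 eqxx.
  by apply: big1 => i _; rewrite !mxE (negPf ev_neq0).
pose K := cokermx (map_mx intr M : 'M[rat]_(_, n)).
pose q t : 'rV[rat]_n := map_mx intr (vec t).
have [z z_generic] := generic_functional [seq q t *m K | t <- enum {: T}].
exists (fun i => (K *m z) i 0) => e e_le1.
have [t te] := vec_onto (\row_i e i) (fun i => ltac:(rewrite mxE; exact: e_le1)).
have eE i : e i = vec t 0 i by rewrite -te mxE.
transitivity (ev (vec t) == 0).
  by congr (_ == 0); apply: eq_bigr => i _; rewrite eE.
transitivity (q t *m (K *m z) == 0); last first.
  have qtE : (q t *m (K *m z)) 0 0 = \sum_i (K *m z) i 0 *~ e i.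
    rewrite mxE; apply: eq_bigr => i _; rewrite eE -mulrzr mulrC.
    by congr (_ * _); rewrite /q mxE.
  rewrite -qtE; apply/eqP/eqP => [->|qt0]; first by rewrite mxE.
  by apply/matrixP => i j; rewrite !ord1 qt0 mxE.
apply/eqP/eqP => [ev0|].
  have -> : q t = row (enum_rank t) (map_mx intr M).
    by apply/rowP => j; rewrite !mxE enum_rankK ev0 eqxx.
  by rewrite mulmxA -row_mul mulmx_coker row0 mul0mx.
rewrite mulmxA => /z_generic qK0.
have {qK0} /eqP qK0 : q t *m K = 0 by apply: qK0; apply/mapP; exists t; rewrite ?mem_enum.
rewrite -submxE in qK0.
have [d [c [d_neq0 d_le dE]]] := integral_multiple_in_rowspan M_le1 qK0.
have evd : ev (vec t) *~ d = 0.
  transitivity (\sum_r ev (row r M) *~ c 0 r); last first.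
    by apply: big1 => r _; rewrite evM mul0rz.
  rewrite /ev mulrz_suml.
  under [RHS]eq_bigr do rewrite mulrz_suml.
  rewrite exchange_big; apply: eq_bigr => i _ /=.
  have /rowP/(_ i) := dE; rewrite !mxE -mulrzA mulrC => ->.
  rewrite mulrz_sumr; apply: eq_bigr => r _.
  by rewrite -mulrzA !mxE mulrC.
apply: (torsion_free `|d|%N); first by move: d_neq0 d_le; lia.
by move: evd; case: (d) => [//|m] /eqP; rewrite NegzE mulrNz oppr_eq0 => /eqP.
Qed.

(** * Words of rotations and reflections *)

(** The cyclic coordinate of a product in the generalized dihedral group of
    [V]: [f] marks the reflections, and each of them negates the contribution of
    all that follows. *)
Fixpoint signed_sum (I : Type) (V : zmodType) (a : I -> V) (f : pred I)
    (w : seq I) : V :=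
  if w is i :: w' then
    a i + (if f i then - signed_sum a f w' else signed_sum a f w')
  else 0.

(** An infix is trivial when it multiplies to the identity, that is when it has
    an even number of reflections and coordinate zero. *)
Definition no_trivial_infix (I : Type) (V : zmodType) (a : I -> V) (f : pred I)
    (w : seq I) : Prop :=
  forall i j, (i < j <= size w)%N ->
    let v := drop i (take j w) in
    ~~ odd (count f v) -> signed_sum a f v = 0 -> i = 0%N /\ j = size w.

Fixpoint sign_coef (I : eqType) (f : pred I) (w : seq I) (j : I) : int :=
  if w is i :: w' then
    if j == i then 1 else (if f i then - sign_coef f w' j else sign_coef f w' j)
  else 0.

Lemma norm_sign_coef (I : eqType) (f : pred I) (w : seq I) (j : I) :
  `|sign_coef f w j| <= 1.
Proof.
by elim: w => //= i w IH; case: eqP => // _; case: (f i); rewrite ?normrN.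
Qed.

Lemma signed_sum_coef (I : finType) (V : zmodType) (a : I -> V) (f : pred I)
    (w : seq I) :
  uniq w -> signed_sum a f w = \sum_j a j *~ sign_coef f w j.
Proof.
elim: w => [_|i w IH] /=; first by rewrite big1.
case/andP=> i_w /IH ->.
have coef_i0 : sign_coef f w i = 0.
  elim: w i_w {IH} => //= k w IH; rewrite inE negb_or => /andP[/negPf-> /IH->].
  by rewrite oppr0; case: ifP.
rewrite [in RHS](bigD1 i) //= eqxx; congr (_ + _).
rewrite [in LHS](bigD1 i) //= coef_i0 add0r.
case: (f i); rewrite -?sumrN; apply: eq_bigr => j /negPf->; by rewrite ?mulrNz.
Qed.

(** The triviality of an infix is decided by one linear form with coefficients
    in [{-1, 0, 1}], the same for [a] and [b]. *)
Lemma no_trivial_infix_transfer (I : finType) (V W : zmodType) (a : I -> V)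
    (b : I -> W) (f : pred I) (w : seq I) :
  (forall e : I -> int, (forall i, `|e i| <= 1) ->
    (\sum_i a i *~ e i == 0) = (\sum_i b i *~ e i == 0)) ->
  uniq w -> no_trivial_infix b f w -> no_trivial_infix a f w.
Proof.
move=> same_relations uniq_w free_b i j lt_ij v v_even v_sum0.
apply: free_b => //.
have uniq_v : uniq v by rewrite drop_uniq ?take_uniq.
apply/eqP; rewrite (signed_sum_coef b f uniq_v) -same_relations.
  by rewrite -signed_sum_coef // v_sum0.
exact: norm_sign_coef.
Qed.

(** * Orderings when there is a reflection *)

(** Conjugation by a translation moves all the reflections by a same amount [c],
    and fixes the products with an even number of reflections. *)
Lemma signed_sum_shift (I : Type) (V : zmodType) (a : I -> V) (f : pred I)
    (c : V) (w : seq I) :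
  signed_sum a f w =
    signed_sum (fun i => a i - c *+ f i) f w + c *+ odd (count f w).
Proof.
elim: w => [|i w IH] /=; first by rewrite addr0.
rewrite IH oddD oddb; case: (f i); case: odd; rewrite /= ?mulr1n ?mulr0n ?subr0 ?addr0.
- by rewrite opprD addrA addrAC.
- by rewrite addrAC subrK.
- by rewrite addrA.
- by [].
Qed.

(** The boolean [e] is the side on which the walk currently stands (false for
    the side of the identity).  An element moves the walk to the right exactly
    when its sign, negative if [neg], is the one of the side. *)
Fixpoint matched (I : Type) (f neg : pred I) (e : bool) (w : seq I) : bool :=
  if w is i :: w' then (neg i == e) && matched f neg (e (+) f i) w' else true.

Lemma matched_cat (I : Type) (f neg : pred I) e (u v : seq I) :
  matched f neg e (u ++ v) =
    matched f neg e u && matched f neg (e (+) odd (count f u)) v.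
Proof.
elim: u e => [|i u IH] e /=; first by rewrite addbF.
by rewrite IH andbA oddD oddb addbA.
Qed.

(** Rotations do not change side, so those whose sign fits the current side can
    be used there in any order. *)
Lemma matched_loops (I : Type) (f neg : pred I) e (w : seq I) :
  all (fun i => ~~ f i && (neg i == e)) w ->
  matched f neg e w /\ count f w = 0%N.
Proof.
elim: w => //= i w IH /andP[/andP[/negPf-> /eqP->] /IH[mw cw]].
by rewrite addbF eqxx mw cw.
Qed.

(** The reflections must alternate between the two signs, which is possible
    when the numbers of both are equal or differ by one in favour of the sign
    that comes first. *)
Lemma matched_alternating (I : eqType) (f neg : pred I) e (s t : seq I) :
  (size t <= size s <= (size t).+1)%N ->
  all (fun i => f i && (neg i == e)) s ->
  all (fun i => f i && (neg i == ~~ e)) t ->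
  exists2 w, perm_eq w (s ++ t) & matched f neg e w.
Proof.
have [n] := ubnP (size s + size t)%N.
elim: n e s t => // n IH e [|x s] t /= lt_n size_st.
  by case: t size_st {lt_n} => // _ _ _; exists [::].
move=> /andP[/andP[fx negx] all_s] all_t.
have [||//||w w_perm w_matched] := IH (~~ e) t s.
- by rewrite addnC; lia.
- lia.
- by rewrite negbK.
exists (x :: w) => /=; last by rewrite negx fx addbT.
by rewrite perm_cons (perm_trans w_perm) // perm_catC.
Qed.

(** Along a matched word all contributions have the same sign, so they cannot
    cancel. *)
Lemma matched_signed_sum (I : Type) (R : realFieldType) (b : I -> R)
    (f : pred I) e (w : seq I) :
  matched f (fun i => b i < 0) e w ->
  signed_sum b f w = (-1) ^+ e * \sum_(i <- w) `|b i|.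
Proof.
elim: w e => [|i w IH] e /=; first by rewrite big_nil mulr0.
rewrite big_cons mulrDr => /andP[/eqP sgn_i /IH ->].
have -> : (-1) ^+ e * `|b i| = b i.
  rewrite -sgn_i; case: ltP => b_i; last by rewrite mul1r ger0_norm.
  by rewrite mulN1r ltr0_norm ?opprK.
by case: (f i); rewrite ?addbT ?addbF // signrN mulNr opprK.
Qed.

Lemma gap_below (R : realFieldType) (y : R) (s : seq R) :
  exists2 c, c < y & forall z, z \in s -> z < y -> z < c.
Proof.
elim: s => [|x s [c lt_cy gap]]; first by exists (y - 1); rewrite ?gtrBl.
exists (if x < y then Num.max c ((x + y) / 2) else c).
  by case: (ltP x y) => // lt_xy; rewrite gt_max lt_cy /=; lra.
move=> z; rewrite inE => /orP[/eqP->|z_s] lt_zy.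
  by rewrite lt_zy lt_max; apply/orP; right; lra.
by case: ifP => _; rewrite ?lt_max gap.
Qed.

(** The threshold is placed in the gap just below the element of rank [h] of the
    sorted sequence. *)
Lemma threshold (R : realFieldType) (s : seq R) (h : nat) :
  uniq s -> (h < size s)%N ->
  exists2 c, c \notin s & count (fun z => z < c) s = h.
Proof.
move=> uniq_s lt_h; pose s' := sort <=%O s.
have s'_sorted : sorted <%O s' by rewrite sort_lt_sorted.
pose y := nth 0 s' h.
have [c lt_cy gap] := gap_below y s.
have below z : z \in s -> (z < c) = (z < y).
  by move=> z_s; apply/idP/idP => [/lt_trans|/gap]; [apply | apply].
exists c.
  by apply/negP => c_s; have := below c c_s; rewrite ltxx lt_cy.
rewrite (eq_in_count below) -(seq.permP (permEl (perm_sort <=%O s))).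
by rewrite count_lt_nth ?size_sort.
Qed.

Lemma big_norm_gt0 (I : eqType) (R : realFieldType) (b : I -> R) (v : seq I) :
  {in v, forall i, b i != 0} -> v != [::] -> 0 < \sum_(i <- v) `|b i|.
Proof.
case: v => // i v b_neq0 _; rewrite big_cons ltr_pwDl ?sumr_ge0 //.
by rewrite normr_gt0 b_neq0 // inE eqxx.
Qed.

(** The positive rotations are used at the start, the negative ones right after
    the first reflection, and the remaining reflections alternate. *)
Lemma matched_word_exists (I : eqType) (f neg : pred I) (s : seq I) :
  has f s ->
  (count (fun i => f i && neg i) s = (count f s)./2)%N ->
  exists2 w, perm_eq w s & matched f neg false w.
Proof.
move=> has_refl half_neg.
pose loops e := [seq i <- s | ~~ f i && (neg i == e)].
pose flips e := [seq i <- s | f i && (neg i == e)].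
have size_neg : size (flips true) = (count f s)./2.
  by rewrite size_filter -half_neg; apply: eq_count => i; rewrite eqb_id.
have size_pos : size (flips false) = uphalf (count f s).
  have : (size (flips true) + size (flips false) = count f s)%N.
    rewrite !size_filter; elim: (s) => //= i s' <-.
    by case: (f i); case: (neg i) => /=; lia.
  by rewrite size_neg; lia.
have loops_all e : all (fun i => ~~ f i && (neg i == e)) (loops e).
  exact: filter_all.
have flips_all e : all (fun i => f i && (neg i == e)) (flips e).
  exact: filter_all.
have s_perm : perm_eq (loops false ++ flips false ++ loops true ++ flips true) s.
  apply/seq.permP => p; rewrite !count_cat !count_filter.
  elim: (s) => //= i s' <-.
  by case: (p i); case: (f i); case: (neg i) => /=; lia.
have := flips_all false; case def_pos: (flips false) size_pos s_perm => [|h t] /=.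
  by move=> size_pos; move: has_refl; rewrite has_count; lia.
move=> size_pos s_perm /andP[/andP[fh /eqP neg_h] all_t].
have [|||w w_perm w_matched] := @matched_alternating _ f neg true (flips true) t.
- by rewrite size_neg; lia.
- exact: flips_all.
- exact: all_t.
have [mP cP] := matched_loops (loops_all false).
have [mN cN] := matched_loops (loops_all true).
exists (loops false ++ h :: loops true ++ w).
  apply: perm_trans s_perm; rewrite perm_cat2l perm_cons.
  rewrite perm_sym perm_catCA perm_cat2l perm_sym (perm_trans w_perm) //.
  by rewrite perm_catC.
by rewrite matched_cat mP cP /= neg_h fh matched_cat mN cN.
Qed.

(** Subtracting the threshold from the reflections balances their signs without
    changing which infixes are trivial. *)
Lemma ordering_with_reflections (I : eqType) (R : realFieldType) (b : I -> R)
    (f : pred I) (s : seq I) :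
  has f s -> {in s, forall i, ~~ f i -> b i != 0} ->
  uniq [seq b i | i <- s & f i] ->
  exists2 w, perm_eq w s & no_trivial_infix b f w.
Proof.
move=> has_refl b_neq0 b_uniq.
have lt_half : ((count f s)./2 < size [seq b i | i <- s & f i])%N.
  rewrite size_map size_filter (@eq_count _ _ f) //.
  by move: has_refl; rewrite has_count; lia.
have [c c_notin c_half] := threshold b_uniq lt_half.
pose b' i := b i - c *+ f i.
have b'_neq0 : {in s, forall i, b' i != 0}.
  move=> i i_s; rewrite /b'; case fi: (f i); last first.
    by rewrite subr0 b_neq0 ?fi.
  rewrite mulr1n subr_eq0; apply: contraNneq c_notin => <-.
  by apply: map_f; rewrite mem_filter fi.
have [|w w_perm w_matched] := @matched_word_exists _ f (fun i => b' i < 0) s has_refl.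
  rewrite -[RHS]c_half count_map count_filter; apply: eq_count => i /=.
  by rewrite andbC /b'; case: (f i); rewrite ?andbF // !andbT subr_lt0.
exists w => // i j /andP[lt_ij le_jw] v v_even v_sum0; exfalso.
have v_s : {subset v <= s}.
  by move=> x /mem_drop/mem_take; rewrite (perm_mem w_perm).
have v_nnil : v != [::].
  by rewrite -size_eq0 size_drop size_takel // subn_eq0 -ltnNge.
have [e v_matched] : exists e, matched f (fun i => b' i < 0) e v.
  move: w_matched; rewrite -(cat_take_drop j w) matched_cat => /andP[+ _].
  by rewrite -(cat_take_drop i (take j w)) matched_cat => /andP[_ ?]; eexists; eauto.
have /lt0r_neq0/negP[] := big_norm_gt0 (sub_in1 v_s b'_neq0) v_nnil.
move: v_sum0.
rewrite (signed_sum_shift _ _ c) (negPf v_even) addr0 (matched_signed_sum v_matched).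
by move/eqP; rewrite mulf_eq0 signr_eq0.
Qed.

(** * Orderings when all elements are rotations *)

Lemma sum_take_lt (I : eqType) (R : numDomainType) (g : I -> R) (s : seq I)
    (k l : nat) :
  {in s, forall i, 0 < g i} -> (k < l <= size s)%N ->
  \sum_(i <- take k s) g i < \sum_(i <- take l s) g i.
Proof.
move=> g_gt0 /andP[lt_kl le_ls].
rewrite -[in ltRHS](cat_take_drop k (take l s)) take_takel ?(ltnW lt_kl) //.
rewrite big_cat ltrDl /=.
have : {in drop k (take l s), forall i, 0 < g i}.
  by move=> i /mem_drop/mem_take/g_gt0.
have : size (drop k (take l s)) != 0%N.
  by rewrite size_drop size_takel // subn_eq0 -ltnNge.
case: (drop _ _) => // i v _ v_gt0; rewrite big_cons ltr_pwDl ?v_gt0 ?inE ?eqxx //.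
by rewrite big_seq sumr_ge0 // => j jv; rewrite ltW ?v_gt0 // inE jv orbT.
Qed.

(** Induction from the top.  Say the sum of [s] is at least that of [t], and put
    last some [x] in [s] for which the sums of [s] without [x] and of [t] differ.
    Then the smaller instance has no coincidence at its full lengths, and the new
    partial sum, that of all of [s], exceeds every partial sum of [t] but
    possibly the last one.  As [g] is injective on [s], at most one choice of
    [x] is excluded, so one is left unless [s] is a singleton; in that case the
    smaller instance has an empty side, and only the empty sums can coincide. *)
Lemma disjoint_partial_sums (I : eqType) (R : realDomainType) (g : I -> R)
    (s t : seq I) :
  {in s, forall i, 0 < g i} -> {in t, forall i, 0 < g i} ->
  uniq (map g s) -> uniq (map g t) ->
  exists s' t', [/\ perm_eq s' s, perm_eq t' t &
    forall k l, (k <= size s')%N -> (l <= size t')%N ->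
      \sum_(i <- take k s') g i = \sum_(i <- take l t') g i ->
      (k = 0 /\ l = 0)%N \/ (k = size s' /\ l = size t')].
Proof.
have [n] := ubnP (size s + size t)%N.
elim: n s t => // n IH s t lt_n gs gt us ut.
wlog le_ts : s t lt_n gs gt us ut / \sum_(i <- t) g i <= \sum_(i <- s) g i.
  move=> wl; case: (leP (\sum_(i <- t) g i) (\sum_(i <- s) g i)) => [|/ltW] le.
    exact: wl.
  have [|t' [s' [t'_perm s'_perm disj]]] := wl t s _ gt gs ut us le.
    by rewrite addnC.
  exists s', t'; split=> // k l le_k le_l sum_eq.
  by have [[-> ->]|[-> ->]] := disj l k le_l le_k (esym sum_eq); [left|right].
have sum_eq0 u : {in u, forall i, 0 < g i} -> \sum_(i <- u) g i <= 0 -> u = [::].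
  case: u => // x u gu; rewrite big_cons leNgt ltr_pwDl ?gu ?inE ?eqxx //.
  by rewrite big_seq sumr_ge0 // => i iu; rewrite ltW ?gu // inE iu orbT.
have take_full u l : {in u, forall i, 0 < g i} -> (l <= size u)%N ->
    \sum_(i <- u) g i <= \sum_(i <- take l u) g i -> l = size u.
  move=> gu le_l; rewrite -{1}(take_size u) leNgt; apply: contraNeq => ne_l.
  by rewrite sum_take_lt // ltn_neqAle ne_l le_l leqnn.
have [s0|[x [x_s gap]]] : s = [::] \/ exists x, x \in s /\
    (\sum_(i <- rem x s) g i != \sum_(i <- t) g i \/ rem x s = [::]).
- case: s us {gs le_ts lt_n} => [|x [|y s]] us; first by left.
    by right; exists x; rewrite /= eqxx inE eqxx; split=> //; right.
  right; case: (eqVneq (\sum_(i <- y :: s) g i) (\sum_(i <- t) g i)) => [sum_y|].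
    exists y; rewrite !inE eqxx orbT; split=> //; left; rewrite -sum_y.
    have xy : x != y by apply: contraTneq us => ->; rewrite /= inE eqxx.
    rewrite /= eqxx (negPf xy) !big_cons -subr_eq0 opprD addrACA subrr addr0.
    by rewrite subr_eq0; apply: contraTneq us => /= ->; rewrite inE eqxx.
  by move=> ?; exists x; rewrite !inE eqxx; split=> //; left; rewrite /= eqxx.
- have t0 : t = [::] by apply: sum_eq0 gt _; rewrite s0 big_nil in le_ts.
  exists [::], [::]; rewrite s0 t0; split=> // k l /=; rewrite !leqn0.
  by move=> /eqP-> /eqP->; left.
have s_perm := perm_to_rem x_s.
have sumE : \sum_(i <- s) g i = g x + \sum_(i <- rem x s) g i.
  by rewrite (perm_big _ s_perm) big_cons.
have [|||//||s' [t' [s'_perm t'_perm disj]]] := IH (rem x s) t.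
- by rewrite size_rem //; case: (s) x_s lt_n => //= *; lia.
- by move=> i /mem_rem /gs.
- exact: gt.
- by move: us; rewrite (perm_uniq (perm_map g s_perm)) => /andP[].
- exact: ut.
exists (rcons s' x), t'; split=> //.
  by rewrite perm_rcons perm_sym (perm_trans s_perm) // perm_cons perm_sym.
have sum_s' : \sum_(i <- s') g i = \sum_(i <- rem x s) g i by apply: perm_big.
have sum_t' : \sum_(i <- t') g i = \sum_(i <- t) g i by apply: perm_big.
have gt' : {in t', forall i, 0 < g i} by move=> i; rewrite (perm_mem t'_perm) => /gt.
move=> k l; rewrite size_rcons leq_eqVlt ltnS => /predU1P[->|le_k] le_l sum_eq.
  right; split=> //; apply: take_full => //; rewrite -sum_eq sum_t'.
  rewrite take_oversize ?size_rcons // -cats1 big_cat big_seq1 /=.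
  by rewrite sum_s' addrC -sumE.
move: sum_eq; rewrite -cats1 takel_cat // => sum_eq.
have [[-> ->]|[kE lE]] := disj k l le_k le_l sum_eq; first by left.
left; case: gap => [/eqP[]|rem0].
  by rewrite -sum_s' -sum_t' -(take_size s') -(take_size t') -kE -lE.
have s'0 : s' = [::] by apply: perm_nilP; rewrite -rem0.
split; first by rewrite kE s'0.
rewrite lE (sum_eq0 t') // -(take_size t') -lE -sum_eq s'0.
by rewrite big_nil.
Qed.

Lemma signed_sum_rotations (I : eqType) (V : zmodType) (a : I -> V) (f : pred I)
    (w : seq I) :
  {in w, forall i, ~~ f i} -> signed_sum a f w = \sum_(i <- w) a i.
Proof.
elim: w => [|i w IH] rot_only; first by rewrite big_nil.
rewrite big_cons /= (negPf (rot_only i _)) ?inE ?eqxx // IH // => j jw.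
by rewrite rot_only // inE jw orbT.
Qed.

(** The positive elements are listed in reverse because
    [disjoint_partial_sums] counts from the turning point. *)
Lemma ordering_without_reflections (I : eqType) (R : realFieldType) (b : I -> R)
    (f : pred I) (s : seq I) :
  {in s, forall i, ~~ f i} -> {in s, forall i, b i != 0} ->
  uniq (map b s) ->
  exists2 w, perm_eq w s & no_trivial_infix b f w.
Proof.
move=> rot_only b_neq0 b_uniq.
pose pos i := 0 < b i; pose neg i := ~~ pos i.
have neg_lt0 i : i \in s -> neg i -> b i < 0.
  by move=> i_s; rewrite /neg /pos -leNgt le_eqVlt (negPf (b_neq0 i i_s)).
have norm_gt0 (p : pred I) : {in [seq i <- s | p i], forall i, 0 < `|b i|}.
  by move=> i; rewrite mem_filter normr_gt0 => /andP[_ /b_neq0].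
have norm_uniq (p : pred I) (c : R) :
    {in [seq i <- s | p i], forall i, `|b i| = c * b i} -> c != 0 ->
    uniq (map (fun i => `|b i|) [seq i <- s | p i]).
  move=> /eq_in_map->; rewrite (map_comp ( *%R c)) => c_neq0.
  rewrite (map_inj_uniq (mulfI c_neq0)).
  exact: subseq_uniq (map_subseq _ (filter_subseq _ _)) b_uniq.
have [||||p [n [p_perm n_perm disj]]] := @disjoint_partial_sums _ _
    (fun i => `|b i|) [seq i <- s | pos i] [seq i <- s | neg i].
- exact: norm_gt0.
- exact: norm_gt0.
- apply: (norm_uniq _ 1); rewrite ?oner_neq0 // => i.
  rewrite mem_filter mul1r => /andP[b_gt0 _].
  exact: gtr0_norm.
- apply: (norm_uniq _ (-1)); rewrite ?oppr_eq0 ?oner_neq0 // => i.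
  rewrite mem_filter mulN1r => /andP[? ?].
  exact/ltr0_norm/neg_lt0.
have p_gt0 : {in p, forall i, 0 < `|b i|}.
  by move=> i; rewrite (perm_mem p_perm) => /norm_gt0.
have n_gt0 : {in n, forall i, 0 < `|b i|}.
  by move=> i; rewrite (perm_mem n_perm) => /norm_gt0.
have p_norm : {in p, forall i, b i = `|b i|}.
  by move=> i; rewrite (perm_mem p_perm) mem_filter => /andP[/gtr0_norm].
have n_norm : {in n, forall i, b i = - `|b i|}.
  move=> i; rewrite (perm_mem n_perm) mem_filter => /andP[i_neg i_s].
  by rewrite ltr0_norm ?opprK ?neg_lt0.
have w_perm : perm_eq (rev p ++ n) s.
  rewrite perm_sym -(perm_filterC pos s) perm_sym perm_cat //.
  by rewrite perm_rev.
exists (rev p ++ n) => // i j /andP[lt_ij le_jw] v _.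
have v_s : {subset v <= s}.
  by move=> x /mem_drop/mem_take; rewrite (perm_mem w_perm).
rewrite signed_sum_rotations => [|x /v_s /rot_only //] v_sum0.
(* [Y k] is the total of the positive elements minus the k-th partial sum; one
   of its two terms is empty, by truncated subtraction. *)
pose Y k := \sum_(i <- take (size p - k) p) `|b i| +
            \sum_(i <- take (k - size p) n) `|b i|.
have take_sum k : \sum_(i <- take k (rev p ++ n)) b i = \sum_(i <- p) `|b i| - Y k.
  have sum_n l : \sum_(x <- take l n) b x = - \sum_(x <- take l n) `|b x|.
    by rewrite -sumrN; apply: eq_big_seq => x /mem_take/n_norm.
  have sum_p u : {subset u <= p} -> \sum_(x <- u) b x = \sum_(x <- u) `|b x|.
    by move=> u_p; apply: eq_big_seq => x /u_p/p_norm.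
  rewrite /Y take_cat size_rev; case: ltnP => [lt_kp|le_pk].
    have /eqP-> : (k - size p == 0)%N by rewrite subn_eq0 ltnW.
    rewrite take0 big_nil addr0 take_rev (perm_big _ (permEl (perm_rev _))) /=.
    rewrite sum_p => [|x /mem_drop //].
    apply/eqP; rewrite eq_sym subr_eq addrC -big_cat /=.
    by rewrite cat_take_drop.
  have /eqP-> : (size p - k == 0)%N by rewrite subn_eq0.
  rewrite take0 big_nil add0r big_cat /= sum_n.
  by rewrite (perm_big _ (permEl (perm_rev _))) /= sum_p.
have Y_eq : Y i = Y j.
  move: v_sum0; have := take_sum j.
  rewrite -(cat_take_drop i (take j _)) take_takel ?(ltnW lt_ij) // big_cat /=.
  by rewrite take_sum => /eqP; rewrite -/v => + v0; rewrite v0 addr0 => /eqP/addrI/oppr_inj.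
move: Y_eq le_jw; rewrite /Y size_cat size_rev => Y_eq le_jw.
case: (leqP j (size p)) Y_eq => [le_jp|lt_pj].
  have /eqP-> : (i - size p == 0)%N by rewrite subn_eq0; lia.
  have /eqP-> : (j - size p == 0)%N by rewrite subn_eq0; lia.
  move/addIr/esym/eqP; rewrite lt_eqF //; apply: sum_take_lt => //; lia.
have /eqP-> : (size p - j == 0)%N by rewrite subn_eq0; lia.
case: (leqP (size p) i) => [le_pi|lt_ip].
  have /eqP-> : (size p - i == 0)%N by rewrite subn_eq0; lia.
  move/addrI/eqP; rewrite lt_eqF //; apply: sum_take_lt => //; lia.
have /eqP-> : (i - size p == 0)%N by rewrite subn_eq0; lia.
rewrite !take0 !big_nil addr0 add0r => /disj[||[]|[]]; lia.
Qed.

(** * Dihedral groups *)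

(** An integer [d <= N] is coprime to [m], as its prime factors are too small to
    divide [m]. *)
Lemma Zm_no_small_torsion (m N : nat) (x : 'I_m.-1.+1) (d : nat) :
  (0 < m)%N -> (forall p, prime p -> p %| m -> N < p)%N ->
  (0 < d <= N)%N -> x *+ d = 0 -> x = 0.
Proof.
move=> m_gt0 large /andP[d_gt0 le_dN] xd0; apply: val_inj => /=.
have coprime_md : coprime m d.
  rewrite /coprime; case: (eqVneq (gcdn m d) 1%N) => // gcd_neq1.
  have gcd_gt1 : (1 < gcdn m d)%N by rewrite ltn_neqAle eq_sym gcd_neq1 gcdn_gt0 m_gt0.
  have p_gcd := pdiv_dvd (gcdn m d).
  have := large _ (pdiv_prime gcd_gt1) (dvdn_trans p_gcd (dvdn_gcdl _ _)).
  have := dvdn_leq d_gt0 (dvdn_trans p_gcd (dvdn_gcdr m d)).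
  by move=> le_pd; rewrite ltnNge (leq_trans le_pd).
have m_xd : (m.-1.+1 %| x * d)%N.
  by move/(congr1 val): xd0; rewrite Zp_mulrn /= => /eqP.
move: (nat_of_ord x) (ltn_ord x) m_xd => y; rewrite prednK // => lt_ym.
rewrite Gauss_dvdl // => m_y; apply/eqP; apply: contraLR lt_ym.
by rewrite -lt0n -leqNgt => /dvdn_leq/(_ m_y).
Qed.

Lemma dihedral_prodE (m : nat) (T : Type) (g : T -> dihedral m) (w : seq T) :
  (\prod_(t <- w) g t)%g =
    (signed_sum (fun t => (g t).1) (fun t => (g t).2 != 0) w,
     (odd (count (fun t => (g t).2 != 0) w))%:R) :> dihedral m.
Proof.
elim: w => [|t w IH]; first by rewrite big_nil.
rewrite big_cons IH dihedral_mulE /=; congr (_, _); first by case: eqP.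
by rewrite oddD oddb; case: (Z2_cases (g t).2) => ->; case: odd; apply: val_inj.
Qed.

Lemma partial_sum_collision (G : groupType) (xs : seq G) (i j : nat) :
  (i <= j)%N -> partial_sum xs i = partial_sum xs j ->
  (\prod_(x <- drop i (take j xs)) x)%g = 1%g.
Proof.
move=> le_ij; rewrite /partial_sum -[in RHS](cat_take_drop i (take j xs)).
rewrite take_takel // big_cat /= -[LHS]mulg1 => /mulgI.
by move=> <-.
Qed.

Lemma sequenceable_of_word (m : nat) (S : {set dihedral m})
    (w : seq 'I_#|S|) :
  perm_eq w (enum 'I_#|S|) ->
  no_trivial_infix (fun i => (enum_val i).1) (fun i => (enum_val i).2 != 0) w ->
  sequenceable S.
Proof.
move=> w_perm w_free; exists (map enum_val w); split.
- by rewrite map_inj_uniq; [rewrite (perm_uniq w_perm) enum_uniq | apply: enum_val_inj].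
- move=> x; apply/mapP/idP => [[i _ ->]|x_S]; first exact: enum_valP.
  exists (enum_rank_in x_S x); last by rewrite enum_rankK_in.
  by rewrite (perm_mem w_perm) mem_enum.
rewrite size_map => i j lt_ij /partial_sum_collision.
case/andP: (lt_ij) => /ltnW le_ij _ /(_ le_ij).
rewrite -map_take -map_drop big_map dihedral_prodE dihedral_oneE => -[sum0 par0].
apply: w_free => //.
by case: odd par0.
Qed.

Lemma sum_mulrz_delta (I : finType) (V : zmodType) (c : I -> V) (i : I) :
  \sum_l c l *~ (l == i)%:Z = c i.
Proof. by rewrite (bigD1 i) //= eqxx big1 ?addr0 // => l /negPf->. Qed.

Lemma sum_mulrz_delta2 (I : finType) (V : zmodType) (c : I -> V) (i j : I) :
  \sum_l c l *~ ((l == i)%:Z - (l == j)%:Z) = c i - c j.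
Proof.
under eq_bigr do rewrite mulrzBr.
by rewrite sumrB !sum_mulrz_delta.
Qed.

Local Close Scope ring_scope.

Theorem corollary3p5 (m k : nat) (m_ge1 : 1 <= m) (k_ge1 : 1 <= k)
    (large_primes : forall p : nat, prime p -> p %| m -> k`! < p)
    (S : {set dihedral m}) (S_nonzero : S \subset [set: dihedral m] :\ 1%g)
    (cardS : #|S| = k) :
  sequenceable S.
Proof.
pose a (i : 'I_#|S|) := (enum_val i).1.
pose f (i : 'I_#|S|) := ((enum_val i).2 != 0)%R.
have [b same_relations] : exists b : 'I_#|S| -> rat,
    forall e : 'I_#|S| -> int, (forall i, `|e i| <= 1)%R ->
    (\sum_i a i *~ e i == 0)%R = (\sum_i b i *~ e i == 0)%R.
  apply: rectification => d x; rewrite cardS => d_bounds.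
  exact: Zm_no_small_torsion d_bounds.
(* The forms giving a single coordinate or the difference of two are among those
   preserved, so [b] keeps rotations nontrivial and elements distinct. *)
have b_neq0 i : ~~ f i -> (b i != 0)%R.
  rewrite negbK => /eqP rot_i; rewrite -(sum_mulrz_delta b) -same_relations.
    rewrite sum_mulrz_delta; apply: contraTneq (subsetP S_nonzero _ (enum_valP i)).
    rewrite /a => a_i0; rewrite !inE andbT negbK dihedral_oneE.
    by rewrite [enum_val i]surjective_pairing a_i0 rot_i.
  by move=> l; case: (l == i).
have b_inj i j : f i = f j -> b i = b j -> i = j.
  move=> fij bij; case: (eqVneq i j) => // i_neq_j; apply: enum_val_inj.
  have a_ij : a i = a j.
    apply/eqP; rewrite -subr_eq0 -sum_mulrz_delta2 same_relations.
      by rewrite sum_mulrz_delta2 bij subrr.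
    by move=> l; case: (l == i); case: (l == j).
  rewrite [enum_val i]surjective_pairing [RHS]surjective_pairing.
  congr (_, _); first exact: a_ij.
  move: fij; rewrite /f.
  by case: (Z2_cases (enum_val i).2) => ->; case: (Z2_cases (enum_val j).2) => ->.
have [w w_perm w_free] : exists2 w, perm_eq w (enum 'I_#|S|) & no_trivial_infix b f w.
  have uniq_b (p : pred 'I_#|S|) : (forall i j, p i -> p j -> f i = f j) ->
      uniq [seq b i | i <- enum 'I_#|S| & p i].
    move=> p_f; rewrite map_inj_in_uniq; first exact/filter_uniq/enum_uniq.
    move=> i j; rewrite !mem_filter => /andP[pi _] /andP[pj _]; apply: b_inj; exact: p_f.
  have [has_refl|no_refl] := boolP (has f (enum 'I_#|S|)).
    apply: ordering_with_reflections => //.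
      by move=> i _; apply: b_neq0.
    by apply: uniq_b => i j -> ->.
  have f0 i : ~~ f i by move/hasPn: no_refl; apply; rewrite mem_enum.
  apply: ordering_without_reflections => [i _|i _|].
  - exact: f0.
  - exact: b_neq0.
  - rewrite -[enum _](filter_predT); apply: uniq_b => i j _ _.
    by rewrite (negPf (f0 i)) (negPf (f0 j)).
apply: (sequenceable_of_word w_perm); apply: no_trivial_infix_transfer w_free.
  exact: same_relations.
by rewrite (perm_uniq w_perm) enum_uniq.
Qed.
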